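(* Let $\mathcal{H}$ be a Hilbert space of finite dimension $d$ with fixed computational basis $\{|j\rangle\}_{j=1}^d$, and let $f_1=|f_1\rangle\langle f_1|$ with $|f_1\rangle=\frac{1}{\sqrt d}\sum_{j=1}^d|j\rangle$. Let $\alpha\in(0,1)$ and $z\geqslant\max\{\alpha,1-\alpha\}$. For $\rho\in\mathcal{D}(\mathcal{H})$ define $$\mathcal{T}^{\mathrm{GR}}_{\alpha,z}(\rho)=1-f_{\alpha,z}(f_1\|\rho),\qquad f_{\alpha,z}(\tau\|\sigma)=\operatorname{Tr}\Big[\big(\sigma^{\frac{1-\alpha}{2z}}\tau^{\frac{\alpha}{z}}\sigma^{\frac{1-\alpha}{2z}}\big)^z\Big].$$ Then $\mathcal{T}^{\mathrm{GR}}_{\alpha,z}$ is a valid texture measure, that is: (T1) $\mathcal{T}^{\mathrm{GR}}_{\alpha,z}(\rho)\geqslant 0$ for every $\rho\in\mathcal{D}(\mathcal{H})$, and $\mathcal{T}^{\mathrm{GR}}_{\alpha,z}(f_1)=0$; (T2) $\mathcal{T}^{\mathrm{GR}}_{\alpha,z}(\rho)\geqslant\mathcal{T}^{\mathrm{GR}}_{\alpha,z}(\Phi(\rho))$ for every $\rho\in\mathcal{D}(\mathcal{H})$ and every texture-free operation $\Phi$; (T3) $\mathcal{T}^{\mathrm{GR}}_{\alpha,z}\big(\sum_n p_n\rho_n\big)\leqslant\sum_n p_n\mathcal{T}^{\mathrm{GR}}_{\alpha,z}(\rho_n)$ for every finite family of states $\rho_n\in\mathcal{D}(\mathcal{H})$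 and every probability distribution $\{p_n\}$ ($p_n\geqslant 0$, $\sum_n p_n=1$).
   Context: $\mathcal{D}(\mathcal{H})$ is the set of density matrices (positive semidefinite operators of trace one) on $\mathcal{H}$. Powers of positive semidefinite operators are defined by functional calculus; all exponents here are positive, so $0^p=0$. One also has $f_{\alpha,z}(\tau\|\sigma)=\operatorname{Tr}[(\tau^{\frac{\alpha}{2z}}\sigma^{\frac{1-\alpha}{z}}\tau^{\frac{\alpha}{2z}})^z]$. A texture-free operation is a completely positive trace-preserving map $\Phi$ on operators on $\mathcal{H}$ with $\Phi(f_1)=f_1$. *)

(* Defs.v *)
From mathcomp Require Import all_boot all_order all_algebra.
From mathcomp Require Import reals exp.
From mathcomp Require Import complex mxtens.

Set Implicit Arguments.
Unset Strict Implicit.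
Unset Printing Implicit Defensive.

Import Order.TTheory GRing.Theory Num.Theory.

Local Open Scope ring_scope.
Local Open Scope complex_scope.
Local Open Scope sesquilinear_scope.

Section TextureDefs.
Variable R : realType.
Local Notation C := R[i].

(* In the order of [R[i]], [0 <= c] means that [c] is real and nonnegative. *)
Definition psdmx n (A : 'M[C]_n) : Prop :=
  A \is hermsymmx /\ forall v : 'cV[C]_n, 0 <= (v ^t* *m A *m v) 0 0.

Definition densitymx n (rho : 'M[C]_n) : Prop := psdmx rho /\ \tr rho = 1.

(* Functional calculus of a Hermitian [A]: the library provides
   [A = P^-1 *m diag_mx s *m P] with [P := spectralmx A] unitary and
   [s := spectral_diag A] real, whence the projection [complex.Re]. *)
Definition hermfun (f : R -> R) n (A : 'M[C]_n) : 'M[C]_n :=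
  invmx (spectralmx A)
    *m diag_mx (map_mx (fun c => (f (complex.Re c))%:C) (spectral_diag A))
    *m spectralmx A.

(* [powR 0 p = 0] as soon as [p != 0]. *)
Definition mxpowR n (A : 'M[C]_n) (p : R) : 'M[C]_n :=
  hermfun (fun x => powR x p) A.

Lemma mxtrace_hermfun (f : R -> R) n (A : 'M[C]_n) :
  \tr (hermfun f A)
  = (\sum_i f (complex.Re (spectral_diag A 0 i)))%:C.
Proof.
rewrite /hermfun mxtrace_mulC mulmxA mulmxV ?spectral_unit // mul1mx.
by rewrite mxtrace_diag rmorph_sum; apply: eq_bigr => i _; rewrite mxE.
Qed.

Definition f_az (alpha z : R) n (tau sigma : 'M[C]_n) : R :=
  complex.Re (\tr (mxpowR (mxpowR sigma ((1 - alpha) / (2 * z))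
                             *m mxpowR tau (alpha / z)
                             *m mxpowR sigma ((1 - alpha) / (2 * z))) z)).

(* The trace in [f_az] is real, so that [complex.Re] loses nothing. *)
Lemma f_azE (alpha z : R) n (tau sigma : 'M[C]_n) :
  (f_az alpha z tau sigma)%:C
  = \tr (mxpowR (mxpowR sigma ((1 - alpha) / (2 * z))
                   *m mxpowR tau (alpha / z)
                   *m mxpowR sigma ((1 - alpha) / (2 * z))) z).
Proof. by rewrite /f_az [mxpowR _ z]/mxpowR mxtrace_hermfun. Qed.

Definition ket_f1 (d : nat) : 'cV[C]_d := const_mx ((Num.sqrt d%:R)^-1)%:C.

Definition f1 (d : nat) : 'M[C]_d := ket_f1 d *m (ket_f1 d) ^t*.

Definition T_GR (alpha z : R) d (rho : 'M[C]_d) : R :=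
  1 - f_az alpha z (f1 d) rho.

(* [id_k (x) Phi], on matrices seen as [k x k] block matrices with [n x n]
   blocks through the index bijection [mxtens_index] of [tensmx]. *)
Definition ampliation k n (Phi : 'M[C]_n -> 'M[C]_n) (X : 'M[C]_(k * n)) :
    'M[C]_(k * n) :=
  \sum_(a < k) \sum_(b < k)
    delta_mx a b *t Phi (\matrix_(i, j) X (mxtens_index (a, i))
                                          (mxtens_index (b, j))).

Definition completely_positive n (Phi : 'M[C]_n -> 'M[C]_n) : Prop :=
  forall k (X : 'M[C]_(k * n)), psdmx X -> psdmx (ampliation Phi X).

Definition trace_preserving n (Phi : 'M[C]_n -> 'M[C]_n) : Prop :=
  forall X, \tr (Phi X) = \tr X.

Definition texture_free d (Phi : {linear 'M[C]_d -> 'M[C]_d}) : Prop :=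
  [/\ completely_positive Phi, trace_preserving Phi & Phi (f1 d) = f1 d].

End TextureDefs.

Arguments f1 {R} d.

(* Main.v *)
(* Since the reference state is the rank-one projection on [f], [f_az alpha z (f1 d) rho]
   is [<f| rho^s |f> ^ z] with [s := (1 - alpha) / z] in (0, 1].  All three properties then
   follow from one Jensen-type inequality for [x |-> x^s]: if
   [\sum_i c_i L_i† A_i L_i <= B] and [\sum_i L_i† L_i <= 1] then
   [\sum_i c_i^s <L_i v| A_i^s |L_i v> <= <v| B^s |v>].
   It is proved first for [x |-> t x / (x + t)], where the form in [a] is the infimum over
   [b] of [x |b|^2 + t |a - b|^2], and is transferred to powers by writing [x^s] as a limit
   of nonnegative combinations of such functions.
   - (T3): the superlevel sets of [rho |-> <f| rho^s |f>^(1/s)] are convex and this function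
     is homogeneous of degree 1, hence it is concave; composing with the concave increasing
     [x |-> x^(1 - alpha)] gives [<f| rho^s |f>^z].
   - (T2): when [Phi] fixes the projection on [f], the compression [K x := Phi(x f†) f]
     satisfies [K A K† <= Phi(A)] for [A >= 0] by 2-positivity, is a contraction by trace
     preservation, and [K† f = f]; the inequality with [L := K†] compares [A^s] with
     [Phi(A)^s] at [f]. *)

Require Import Defs.
From mathcomp Require Import all_boot all_order all_algebra.
From mathcomp Require Import reals exp.
From mathcomp Require Import complex mxtens.
From mathcomp Require Import boolp classical_sets topology normedtype sequences.
From mathcomp Require Import ring lra.
Import Order.TTheory GRing.Theory Num.Theory.
Import numFieldNormedType.Exports.
Local Open Scope ring_scope.
Local Open Scope complex_scope.

Set Implicit Arguments.
Unset Strict Implicit.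
Unset Printing Implicit Defensive.

(** * Scalar series that recover the powers [x ^ s] *)

Section PowerAsResolventSeries.
Local Open Scope classical_set_scope.
Context {R : realType}.
Variables q r : R.
Hypotheses (r1 : 1 < r) (rq : r < q).

Definition posterm (x : R) : R ^nat := fun k => r ^+ k * (x / (x + q ^+ k)).
Definition negterm (x : R) : R ^nat :=
  fun k => r ^- k.+1 * (x / (x + q ^- k.+1)).

(* The bilateral series of the [r ^ k * (x / (x + q ^ k))], k in Z.  Shifting k gives
   [resolvent_sum (q * x) = r * resolvent_sum x]; when [r = q `^ s], monotonicity then
   makes it proportional to [x `^ s] up to a factor [r], which can be taken near 1. *)
Definition resolvent_sum (x : R) : R :=
  limn (series (posterm x)) + limn (series (negterm x)).

Let r0 : 0 < r. Proof. exact: lt_trans ltr01 r1. Qed.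
Let q0 : 0 < q. Proof. exact: lt_trans r0 rq. Qed.

Let frac_le1 (x y : R) : 0 < x -> 0 < y -> x / (x + y) <= 1.
Proof. by move=> x0 y0; rewrite ler_pdivrMr ?addr_gt0// mul1r lerDl ltW. Qed.

Let frac_gt0 (x y : R) : 0 < x -> 0 < y -> 0 < x / (x + y).
Proof. by move=> x0 y0; rewrite divr_gt0 ?addr_gt0. Qed.

Let fracM (x y : R) : q * x / (q * x + q * y) = x / (x + y).
Proof. by rewrite -mulrDr -mulf_div divff ?mul1r// gt_eqF. Qed.

Let posterm_gt0 x k : 0 < x -> 0 < posterm x k.
Proof. by move=> x0; rewrite mulr_gt0 ?frac_gt0 ?exprn_gt0. Qed.

Let negterm_gt0 x k : 0 < x -> 0 < negterm x k.
Proof. by move=> x0; rewrite mulr_gt0 ?frac_gt0 ?invr_gt0 ?exprn_gt0. Qed.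

(** The [k]-th term is at most [x * (r / q) ^ k], and this geometric series converges because
    [r < q]. *)
Let cvg_posterm x : 0 < x -> cvgn (series (posterm x)).
Proof.
move=> x0; apply: (@series_le_cvg _ _ (geometric x (r / q))).
- by move=> k; exact/ltW/posterm_gt0.
- by move=> k; rewrite /geometric /= mulr_ge0 ?exprn_ge0 ?divr_ge0// ltW.
- move=> k; rewrite /geometric/= expr_div_n mulrCA.
  rewrite ler_pM2l ?exprn_gt0// ler_pM2l// lef_pV2 ?posrE ?addr_gt0 ?exprn_gt0//.
  by rewrite lerDr ltW.
- apply: is_cvg_geometric_series.
  by rewrite ger0_norm ?divr_ge0 ?ltW// ltr_pdivrMr// mul1r.
Qed.

Let cvg_negterm x : 0 < x -> cvgn (series (negterm x)).
Proof.
move=> x0; apply: (@series_le_cvg _ _ (geometric r^-1 r^-1)).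
- by move=> k; exact/ltW/negterm_gt0.
- by move=> k; rewrite /geometric /= mulr_ge0 ?exprn_ge0 ?invr_ge0// ltW.
- move=> k; rewrite /geometric/= -exprS exprVn ler_piMr ?invr_ge0 ?exprn_ge0 ?(ltW r0)//.
  by apply: frac_le1 => //; rewrite invr_gt0 exprn_gt0.
- apply: is_cvg_geometric_series.
  by rewrite ger0_norm ?invr_ge0 ?ltW// invf_lt1.
Qed.

Lemma cvg_resolvent_sum x : 0 < x ->
  series (posterm x) n + series (negterm x) n @[n --> \oo] --> resolvent_sum x.
Proof. by move=> x0; apply: cvgD; [exact: cvg_posterm | exact: cvg_negterm]. Qed.

Lemma resolvent_sum_gt0 x : 0 < x -> 0 < resolvent_sum x.
Proof.
move=> x0; apply: (@lt_le_trans _ _ (posterm x 0)); first exact: posterm_gt0.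
rewrite -[X in X <= _]addr0 lerD//.
  apply: limr_ge; first exact: cvg_posterm.
  exists 1%N => // -[//|n] _; rewrite /series/= big_nat_recl// lerDl.
  by apply: sumr_ge0 => k _; exact/ltW/posterm_gt0.
apply: limr_ge; first exact: cvg_negterm.
exists 0%N => // n _; rewrite /series/=.
by apply: sumr_ge0 => k _; exact/ltW/negterm_gt0.
Qed.

Lemma le_resolvent_sum x y : 0 < x -> x <= y ->
  resolvent_sum x <= resolvent_sum y.
Proof.
move=> x0 xy; have y0 := lt_le_trans x0 xy.
have H t : 0 < t -> x / (x + t) <= y / (y + t).
  move=> t0; rewrite ler_pdivrMr ?addr_gt0// mulrAC ler_pdivlMr ?addr_gt0//.
  by rewrite !mulrDr [y * x]mulrC lerD2l ler_pM2r.
apply: lerD; apply: lim_series_le.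
- exact: cvg_posterm.
- exact: cvg_posterm.
- by move=> k; rewrite ler_pM2l ?exprn_gt0// H ?exprn_gt0.
- exact: cvg_negterm.
- exact: cvg_negterm.
- by move=> k; rewrite ler_pM2l ?invr_gt0 ?exprn_gt0// H ?invr_gt0 ?exprn_gt0.
Qed.

(** The shift carries one term across the cut between the two halves: [posterm (q * x) 0] equals
    [r * negterm x 0]. *)
Lemma resolvent_sumM x : 0 < x -> resolvent_sum (q * x) = r * resolvent_sum x.
Proof.
move=> x0; have qx0 : 0 < q * x by rewrite mulr_gt0.
have rN0 : r != 0 by rewrite gt_eqF.
have qN0 : q != 0 by rewrite gt_eqF.
have A : limn (series (posterm (q * x)))
    = posterm (q * x) 0 + r * limn (series (posterm x)).
  apply: cvg_lim => //; rewrite -cvg_shiftS /=.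
  rewrite [X in X @ _ --> _](_ : _ =
    fun n => posterm (q * x) 0 + r * series (posterm x) n).
    by apply: cvgD; [exact: cvg_cst | apply: cvgM; [exact: cvg_cst|exact: cvg_posterm]].
  apply/funext => n; rewrite /series/= big_nat_recl//; congr (_ + _).
  rewrite mulr_sumr; apply: eq_bigr => k _; rewrite /posterm.
  by rewrite [q ^+ _]exprS fracM exprS -mulrA.
have B : r * limn (series (negterm x))
    = posterm (q * x) 0 + limn (series (negterm (q * x))).
  apply/esym.
  apply: (cvg_unique _ (F := (fun n => r * series (negterm x) n.+1) @ \oo)) => //=.
  - rewrite [X in X @ _ --> _](_ : _ =
      fun n => posterm (q * x) 0 + series (negterm (q * x)) n).
      by apply: cvgD; [exact: cvg_cst | exact: cvg_negterm].
    apply/funext => n; rewrite /series/= big_nat_recl// mulrDr; congr (_ + _).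
      rewrite /negterm/posterm !expr1 !expr0 mulVKf// mul1r -fracM divff//.
    rewrite mulr_sumr; apply: eq_bigr => k _; rewrite /negterm -fracM.
    have e (y : R) : y != 0 -> y * y ^- k.+2 = y ^- k.+1.
      by move=> yN0; rewrite [y ^+ k.+2]exprS invfM mulVKf.
    by rewrite e// mulrA e.
  - apply: cvgM; first exact: cvg_cst.
    by rewrite (cvg_shiftS (series (negterm x))); exact: cvg_negterm.
by rewrite /resolvent_sum A mulrDr B; ring.
Qed.

Lemma resolvent_sumMz (m : int) x : 0 < x ->
  resolvent_sum (q ^ m * x) = r ^ m * resolvent_sum x.
Proof.
have rN0 : r != 0 by rewrite gt_eqF.
have qN0 : q != 0 by rewrite gt_eqF.
have N (n : nat) y : 0 < y -> resolvent_sum (q ^+ n * y) = r ^+ n * resolvent_sum y.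
  move=> y0; elim: n => [|n IH]; first by rewrite !expr0 !mul1r.
  by rewrite !exprS -!mulrA resolvent_sumM ?IH ?mulr_gt0 ?exprn_gt0.
case: m => n x0; first exact: N.
rewrite /exprz -[x in RHS](mulVKf (x := q ^+ n.+1)) ?expf_neq0//.
by rewrite N ?mulr_gt0 ?invr_gt0 ?exprn_gt0// mulKf ?expf_neq0.
Qed.

(** At each power of [q] the two increasing functions [x ^ s * resolvent_sum 1] and
    [resolvent_sum x] agree, and from one power to the next they grow by [r]; in between they differ
    by at most that factor. *)
Lemma resolvent_sum_powR s x : 0 < s -> q `^ s = r -> 0 < x ->
  x `^ s * resolvent_sum 1 <= r * resolvent_sum x /\
  resolvent_sum x <= r * (x `^ s * resolvent_sum 1).
Proof.
move=> s0 qs x0; have G1 := resolvent_sum_gt0 ltr01.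
have q1 : 1 < q := lt_trans r1 rq.
have lq : 0 < ln q by rewrite ln_gt0.
(* Chosen so that [q ^ m <= x < q ^ (m + 1)]. *)
pose m := Num.floor (ln x / ln q).
have /andP[lo hi] := floor_itv (ln x / ln q); rewrite -/m in lo hi.
have qmE (k : int) : q ^ k = expR (k%:~R * ln q).
  by rewrite -powR_intmul ?ltW// /powR gt_eqF.
have qm_le : q ^ m <= x.
  by rewrite qmE -[X in _ <= X]lnK ?posrE// ler_expR -ler_pdivlMr.
have qm_ge : x <= q ^ (m + 1).
  by rewrite qmE -[X in X <= _]lnK ?posrE// ler_expR -ler_pdivrMr// ltW.
have qms (k : int) : (q ^ k) `^ s = r ^ k.
  by rewrite -powR_intmul ?ltW// powRAC qs powR_intmul// ltW.
have qk0 (k : int) : 0 < q ^ k by rewrite exprz_gt0.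
have s_ge (a b : R) : 0 < a -> 0 < b -> a <= b -> a `^ s <= b `^ s.
  by move=> a0 b0 ab; apply: ge0_ler_powR => //; rewrite ?nnegrE ltW.
have := s_ge _ _ (qk0 m) x0 qm_le; rewrite qms => rm_le.
have := s_ge _ _ x0 (qk0 _) qm_ge; rewrite qms exprzDr ?unitfE ?gt_eqF// expr1z => rm_ge.
have := le_resolvent_sum (qk0 m) qm_le.
rewrite -[X in resolvent_sum X <= _]mulr1 resolvent_sumMz// => Gm_le.
have := le_resolvent_sum x0 qm_ge.
rewrite -[X in _ <= resolvent_sum X]mulr1 resolvent_sumMz//.
rewrite exprzDr ?unitfE ?gt_eqF// expr1z => Gm_ge.
split.
  apply: le_trans (_ : r ^ m * r * resolvent_sum 1 <= _); first by rewrite ler_pM2r.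
  by rewrite mulrAC mulrC ler_pM2l.
apply: le_trans Gm_ge _.
by rewrite mulrAC [leLHS]mulrC ler_pM2l// ler_pM2r.
Qed.

End PowerAsResolventSeries.

(** * From the functions [x / (x + t)] to powers *)

Section PowerDomination.
Context {R : realType} {I J : finType}.
Variables (w l : I -> R) (w' l' : J -> R).
Hypotheses (w0 : forall i, 0 <= w i) (l0 : forall i, 0 <= l i).
Hypotheses (w'0 : forall i, 0 <= w' i) (l'0 : forall i, 0 <= l' i).

(** For [r > 1] and [q = r ^ (1 / s)], the hypothesis at the integer powers [t] of [q] compares sums
    of [resolvent_sum]. Replacing it by a power costs a factor [r] on each side, and [r] tends to
    1. *)
Lemma sum_powR_le (s : R) : 0 < s -> s < 1 ->
  (forall t, 0 < t -> \sum_i w i * (l i / (l i + t))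
                      <= \sum_j w' j * (l' j / (l' j + t))) ->
  \sum_i w i * l i `^ s <= \sum_j w' j * l' j `^ s.
Proof.
move=> s0 s1 H; have sN0 : s != 0 by rewrite gt_eqF.
set A := \sum_i _; set B := \sum_j _.
have B0 : 0 <= B by apply: sumr_ge0 => j _; rewrite mulr_ge0 ?powR_ge0.
suff key r : 1 < r -> A <= r ^+ 2 * B.
  apply/ler_addgt0Pr => e e0.
  (* Then [r ^ 2 * B = B + e * B / (B + 1) <= B + e]; the shift by 1 covers [B = 0]. *)
  pose r := Num.sqrt (1 + e / (B + 1)).
  have eB : 0 < e / (B + 1) by rewrite divr_gt0// ltr_wpDl.
  have r1 : 1 < r by rewrite -[X in X < _]sqrtr1 ltr_sqrt ?ltrDl// addr_gt0.
  apply: le_trans (key r r1) _.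
  rewrite sqr_sqrtr ?addr_ge0 ?(ltW eB)// mulrDl mul1r lerD2l.
  rewrite mulrAC ler_pdivrMr ?ltr_wpDl//.
  by rewrite ler_pM2l// lerDl.
move=> r1; have r0 := lt_trans ltr01 r1.
pose q := r `^ s^-1.
have rq : r < q.
  rewrite -[X in X < _]powRr1 ?ltW// /q /powR gt_eqF// ltr_expR ltr_pM2r ?ln_gt0//.
  by rewrite invf_gt1.
have qs : q `^ s = r by rewrite -powRrM mulVf// powRr1// ltW.
have G1 := resolvent_sum_gt0 r1 rq ltr01.
(* The point 0 is set apart because the estimates on [resolvent_sum] ask for [0 < x]. *)
pose g x := if x == 0 then 0 else resolvent_sum q r x.
have gle x : 0 <= x -> x `^ s * resolvent_sum q r 1 <= r * g x /\
                       g x <= r * (x `^ s * resolvent_sum q r 1).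
  rewrite le_eqVlt /g eq_sym; case: eqP => [->|_] //= x0.
    by rewrite powR0// mul0r !mulr0.
  exact: resolvent_sum_powR.
have gAB : \sum_i w i * g (l i) <= \sum_j w' j * g (l' j).
  pose v x n := series (posterm q r x) n + series (negterm q r x) n.
  have cv x : 0 <= x -> (v x n @[n --> \oo] --> g x)%classic.
    rewrite le_eqVlt /g eq_sym; case: eqP => [->|_] //= x0; last exact: cvg_resolvent_sum.
    rewrite (_ : v 0 = fun=> 0); first exact: cvg_cst.
    apply/funext => n; rewrite /v /series /= !big1 ?addr0// => k _.
      by rewrite /negterm mul0r mulr0.
    by rewrite /posterm mul0r mulr0.
  apply: (@ler_cvg_to _ \oo%classic _ _ (fun n => \sum_i w i * v (l i) n)
     (fun n => \sum_j w' j * v (l' j) n)).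
  - apply: cvg_big => [|i _]; first exact: add_continuous.
    by apply: cvgM; [exact: cvg_cst|exact: cv].
  - apply: cvg_big => [|i _]; first exact: add_continuous.
    by apply: cvgM; [exact: cvg_cst|exact: cv].
  exists 0%N => // n _; rewrite /=.
  (* A partial sum is a nonnegative combination of the sums in [H], at [t = q ^ k] and
     [t = q ^- (k + 1)]. *)
  have E (K : finType) (a b : K -> R) : \sum_i a i * v (b i) n =
      \sum_(0 <= k < n) r ^+ k * (\sum_i a i * (b i / (b i + q ^+ k)))
      + \sum_(0 <= k < n) r ^- k.+1 * (\sum_i a i * (b i / (b i + q ^- k.+1))).
    rewrite /v /series /=; under eq_bigr => i _ do rewrite mulrDr !mulr_sumr.
    rewrite big_split/= exchange_big [X in _ + X]exchange_big /=.
    by congr (_ + _); apply: eq_bigr => k _; rewrite mulr_sumr;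
      apply: eq_bigr => i _; rewrite mulrCA.
  have q0 : 0 < q by rewrite powR_gt0.
  rewrite !E; apply: lerD; apply: ler_sum => k _.
    by rewrite ler_pM2l ?H ?exprn_gt0.
  by rewrite ler_pM2l ?H ?invr_gt0 ?exprn_gt0.
rewrite -(ler_pM2r G1).
apply: (@le_trans _ _ (r * \sum_i w i * g (l i))).
  rewrite mulr_suml mulr_sumr; apply: ler_sum => i _.
  by rewrite -mulrA [X in _ <= X]mulrCA ler_wpM2l//; case: (gle (l i)).
apply: (@le_trans _ _ (r * \sum_j w' j * g (l' j))); first by rewrite ler_pM2l.
rewrite expr2 -!mulrA ler_pM2l// mulr_suml mulr_sumr; apply: ler_sum => i _.
by rewrite -mulrA [X in _ <= X]mulrCA ler_wpM2l//; case: (gle (l' i)).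
Qed.
End PowerDomination.

(** * Adjoints, quadratic forms and unitary diagonalisation *)

Section AdjointMatrices.
Local Open Scope sesquilinear_scope.
Local Open Scope ring_scope.
Context {C : numClosedFieldType}.

Lemma hermsymP n (A : 'M[C]_n) : reflect (A = A ^t*) (A \is hermsymmx).
Proof. by apply: (iffP (is_hermitianmxP _ _ _)); rewrite expr0 scale1r. Qed.

Lemma trmxC_mul m n p (A : 'M[C]_(m, n)) (B : 'M[C]_(n, p)) :
  (A *m B) ^t* = B ^t* *m A ^t*.
Proof. by rewrite trmx_mul map_mxM. Qed.

Lemma trmxCB m n (A B : 'M[C]_(m, n)) : (A - B) ^t* = A ^t* - B ^t*.
Proof. by rewrite linearB /= map_mxB. Qed.

Lemma rank1_form n (v u : 'cV[C]_n) :
  (u ^t* *m (v *m v ^t*) *m u) 0 0 = (u ^t* *m v) 0 0 * ((u ^t* *m v) 0 0)^*.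
Proof.
have -> : u ^t* *m (v *m v ^t*) *m u = (u ^t* *m v) *m (u ^t* *m v) ^t*.
  by rewrite trmxC_mul trmxCK !mulmxA.
by rewrite mxE big_ord1 !mxE.
Qed.

Lemma rank1_herm n (v : 'cV[C]_n) : v *m v ^t* \is hermsymmx.
Proof. by apply/hermsymP; rewrite trmxC_mul trmxCK. Qed.

(** Both cross terms equal [|w|^2] since [y† K = w†]. The identity serves to pass a contraction
    bound from [K] to [K†]. *)
Lemma sqr_sub_form m n (K : 'M[C]_(m, n)) (y : 'cV[C]_m) (w := K ^t* *m y) :
  ((y - K *m w) ^t* *m (y - K *m w)) 0 0 =
  (y ^t* *m y) 0 0 - 2 * (w ^t* *m w) 0 0 + ((K *m w) ^t* *m (K *m w)) 0 0.
Proof.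
rewrite trmxCB; have yK : y ^t* *m K = w ^t* by rewrite /w trmxC_mul trmxCK.
rewrite mulmxBl !mulmxBr (mulmxA (y ^t*) K w) yK trmxC_mul.
rewrite -(mulmxA (w ^t*) (K ^t*) y) -/w.
have BE (M N : 'M[C]_1) : (M - N) 0 0 = M 0 0 - N 0 0 by rewrite !mxE.
by rewrite !BE; ring.
Qed.

(** Both cross terms equal 1 because [K v = v]. A contraction [K†] is thereby forced to fix [v]. *)
Lemma fixed_sub_form n (K : 'M[C]_n) (v : 'cV[C]_n) :
  (v ^t* *m v) 0 0 = 1 -> K *m v = v ->
  ((K ^t* *m v - v) ^t* *m (K ^t* *m v - v)) 0 0 =
  ((K ^t* *m v) ^t* *m (K ^t* *m v)) 0 0 - 1.
Proof.
move=> v1 Kv; have vv : v ^t* *m v = 1%:M by rewrite [LHS]mx11_scalar v1.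
have Kvv : v ^t* *m K ^t* *m v = 1%:M by rewrite -trmxC_mul Kv.
have vKv : v ^t* *m K *m v = 1%:M by rewrite -mulmxA Kv.
rewrite trmxCB trmxC_mul trmxCK mulmxBl !mulmxBr vKv vv (mulmxA (v ^t*)) Kvv.
by rewrite subrr subr0 !mxE eqxx.
Qed.

(** Cauchy-Schwarz for a positive two-by-two block form, normalised to 1 in the corner at [v]. *)
Lemma schwarz_block n (u v : 'cV[C]_n) (M : 'I_2 -> 'I_2 -> 'M[C]_n)
    (m := (u ^t* *m M 0 1 *m v) 0 0) :
  (forall y : 'I_2 -> 'cV[C]_n,
     0 <= \sum_a \sum_b ((y a) ^t* *m M a b *m y b) 0 0) ->
  M 1 0 = (M 0 1) ^t* -> (v ^t* *m M 1 1 *m v) 0 0 = 1 ->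
  m^* * m <= (u ^t* *m M 0 0 *m u) 0 0.
Proof.
move=> Mpos M10 M11.
(* With second component [c v] the form is [<u|M 0 0|u> + 2 Re (c m) + |c|^2], minimal at
   [c = - m^*]. *)
have := Mpos (fun a => if a == 0 then u else - (m^* *: v)).
rewrite !big_ord_recl !big_ord0 !addr0 /=.
have -> : lift ord0 ord0 = 1 :> 'I_2 by apply: val_inj.
have E2 : (v ^t* *m M 1 0 *m u) 0 0 = m^*.
  rewrite M10 (_ : _ *m u = (u ^t* *m M 0 1 *m v) ^t*) ?[LHS]mxE ?[X in X^*]mxE//.
  by rewrite !trmxC_mul !trmxCK mulmxA.
have ZN (c : C) : (- (c *: v)) ^t* = - (c^* *: v ^t*).
  by apply/matrixP => i j; rewrite !mxE rmorphN rmorphM.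
have NE (N : 'M[C]_1) : (- N) 0 0 = - N 0 0 by rewrite mxE.
have ZE (c : C) (N : 'M[C]_1) : (c *: N) 0 0 = c * N 0 0 by rewrite mxE.
rewrite ZN !(mulNmx, mulmxN) opprK -?scalemxAl -?scalemxAr -?scalemxAl.
rewrite !(NE, ZE) E2 M11 -/m conjCK mulr1 (mulrC m) addNr addr0 subr_ge0.
by [].
Qed.

(* [diag_in P a] has eigenvalues [a i] in the orthonormal basis formed by the conjugates
   of the rows of the unitary matrix [P]. *)
Definition diag_in n (P : 'M[C]_n) (a : 'I_n -> C) : 'M[C]_n :=
  P ^t* *m diag_mx (\row_i a i) *m P.

Lemma eq_diag_in n (P : 'M[C]_n) (a b : 'I_n -> C) :
  a =1 b -> diag_in P a = diag_in P b.
Proof. by move=> ab; congr (_ *m diag_mx _ *m _); apply/rowP => i; rewrite !mxE. Qed.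

Lemma diag_in_adj n (P : 'M[C]_n) a : (diag_in P a) ^t* = diag_in P (fun i => (a i)^*).
Proof.
rewrite !trmxC_mul trmxCK mulmxA; congr (_ *m _ *m _).
rewrite tr_diag_mx map_diag_mx; congr diag_mx; apply/rowP => i.
by rewrite !mxE.
Qed.

Lemma diag_inZ n (P : 'M[C]_n) k a : diag_in P (fun i => k * a i) = k *: diag_in P a.
Proof.
rewrite /diag_in scalemxAl scalemxAr; congr (_ *m _ *m _).
by apply/matrixP => i j; rewrite !mxE mulrnAr.
Qed.

Lemma diag_in_form n (P : 'M[C]_n) a (v : 'cV[C]_n) :
  (v ^t* *m diag_in P a *m v) 0 0 = \sum_i ((P *m v) i 0)^* * (P *m v) i 0 * a i.
Proof.
rewrite /diag_in !mulmxA -trmxC_mul -mulmxA mxE; apply: eq_bigr => i _.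
by rewrite mul_mx_diag !mxE mulrAC.
Qed.

Lemma diag_in_sum n (P : 'M[C]_n) a :
  diag_in P a = \sum_i a i *: (col i (P ^t*) *m (col i (P ^t*)) ^t*).
Proof.
apply/matrixP => i j; rewrite summxE /diag_in mul_mx_diag mxE; apply: eq_bigr => k _.
rewrite !mxE big_ord1 !mxE conjCK; ring.
Qed.

Section Unitary.
Variables (n : nat) (P : 'M[C]_n).
Hypothesis P_unitary : P \is unitarymx.

Lemma diag_inM a b : diag_in P a *m diag_in P b = diag_in P (fun i => a i * b i).
Proof.
rewrite /diag_in !mulmxA mulmxtVK// -(mulmxA _ (diag_mx _) (diag_mx _)) mulmx_diag.
by congr (_ *m diag_mx _ *m _); apply/rowP => i; rewrite !mxE.
Qed.

Lemma mul_unitaryK m (A : 'M[C]_(n, m)) : P *m (P ^t* *m A) = A.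
Proof. by rewrite mulmxA (unitarymxP _) ?mul1mx. Qed.

Lemma unitary_isometry (v : 'cV[C]_n) : (P *m v) ^t* *m (P *m v) = v ^t* *m v.
Proof.
rewrite trmxC_mul mulmxA -(mulmxA _ _ P) -invmx_unitary// mulVmx ?mulmx1//.
exact: unitarymx_unit.
Qed.

Lemma diag_inE (s : 'rV[C]_n) (f : C -> C) :
  invmx P *m diag_mx (map_mx f s) *m P = diag_in P (fun i => f (s 0 i)).
Proof.
rewrite invmx_unitary//; congr (_ *m diag_mx _ *m _).
by apply/rowP => i; rewrite !mxE.
Qed.

End Unitary.

Lemma hermsym_spectral n (A : 'M[C]_n) : A \is hermsymmx ->
  A = diag_in (spectralmx A) (fun i => spectral_diag A 0 i).
Proof.
move=> /hermitian_normalmx/orthomx_spectralP {1}->.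
rewrite -(diag_inE (spectral_unitarymx A) _ id).
by congr (_ *m diag_mx _ *m _); apply/rowP => i; rewrite !mxE.
Qed.

Lemma spectral_diag_real n (A : 'M[C]_n) i : A \is hermsymmx ->
  spectral_diag A 0 i \is Num.real.
Proof. by move=> /hermitian_spectral_diag_real/mxOverP/(_ 0 i). Qed.

End AdjointMatrices.

(** * Quadratic forms in the functional calculus *)

Section HermitianForms.
Local Open Scope sesquilinear_scope.
Context {R : realType}.
Local Notation C := R[i].

Definition abs2 (c : C) : R := complex.Re c ^+ 2 + complex.Im c ^+ 2.

Lemma abs2_ge0 c : 0 <= abs2 c.
Proof. by rewrite addr_ge0 ?sqr_ge0. Qed.

Lemma abs2E c : (abs2 c)%:C = c^* * c.
Proof. by rewrite mulrC -normCK add_Re2_Im2. Qed.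

Definition sqnorm n (v : 'cV[C]_n) : R := \sum_i abs2 (v i 0).

Lemma sqnorm_ge0 n (v : 'cV[C]_n) : 0 <= sqnorm v.
Proof. by apply: sumr_ge0 => i _; exact: abs2_ge0. Qed.

Lemma sqnormE n (v : 'cV[C]_n) : (sqnorm v)%:C = (v ^t* *m v) 0 0.
Proof.
by rewrite rmorph_sum mxE; apply: eq_bigr => i _; rewrite !mxE -abs2E.
Qed.

Definition eigen n (A : 'M[C]_n) i : R := complex.Re (spectral_diag A 0 i).

Definition coord n (A : 'M[C]_n) (v : 'cV[C]_n) i : C := (spectralmx A *m v) i 0.

(** The real number [<v|F(A)|v>], written over the spectrum so that scalar inequalities apply
    eigenvalue by eigenvalue. *)
Definition hform (F : R -> R) n (A : 'M[C]_n) (v : 'cV[C]_n) : R :=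
  \sum_i abs2 (coord A v i) * F (eigen A i).

Lemma hermfunE F n (A : 'M[C]_n) :
  hermfun F A = diag_in (spectralmx A) (fun i => (F (eigen A i))%:C).
Proof. exact: (diag_inE (spectral_unitarymx A)). Qed.

Lemma hformE F n (A : 'M[C]_n) (v : 'cV[C]_n) :
  (hform F A v)%:C = (v ^t* *m hermfun F A *m v) 0 0.
Proof.
rewrite hermfunE diag_in_form rmorph_sum; apply: eq_bigr => i _.
by rewrite rmorphM /= abs2E.
Qed.

Lemma sqnorm_coord n (A : 'M[C]_n) v : \sum_i abs2 (coord A v i) = sqnorm v.
Proof.
apply: complexI; rewrite -[LHS]/((sqnorm (spectralmx A *m v))%:C) 2!sqnormE.
by rewrite (unitary_isometry (spectral_unitarymx A)).
Qed.

Lemma coord_spectral n (A : 'M[C]_n) (a : 'I_n -> C) i :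
  coord A ((spectralmx A) ^t* *m \col_j a j) i = a i.
Proof. by rewrite /coord (mul_unitaryK (spectral_unitarymx A)) mxE. Qed.

Lemma hform_eigen F n (A : 'M[C]_n) i :
  hform F A ((spectralmx A) ^t* *m \col_j (j == i)%:R) = F (eigen A i).
Proof.
rewrite /hform (bigD1 i)//= big1 ?addr0 => [|j ji]; rewrite coord_spectral.
  by rewrite eqxx /abs2 /= expr1n expr0n/= addr0 mul1r.
by rewrite (negbTE ji) /abs2 /= expr0n /= addr0 mul0r.
Qed.

Lemma eq_hermfun F G n (A : 'M[C]_n) : (forall i, F (eigen A i) = G (eigen A i)) ->
  hermfun F A = hermfun G A.
Proof. by move=> FG; rewrite 2!hermfunE; apply: eq_diag_in => i; rewrite FG. Qed.

Lemma hermfun_herm F n (A : 'M[C]_n) : (hermfun F A) ^t* = hermfun F A.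
Proof.
by rewrite hermfunE diag_in_adj; apply: eq_diag_in => i; exact: conjc_real.
Qed.

Lemma hermfunM F G n (A : 'M[C]_n) :
  hermfun F A *m hermfun G A = hermfun (fun x => F x * G x) A.
Proof.
rewrite 3!hermfunE (diag_inM (spectral_unitarymx A)).
by apply: eq_diag_in => i; rewrite rmorphM.
Qed.

Lemma hermfunZ k F n (A : 'M[C]_n) :
  hermfun (fun x => k * F x) A = k%:C *: hermfun F A.
Proof.
by rewrite 2!hermfunE -diag_inZ; apply: eq_diag_in => i; rewrite rmorphM.
Qed.

Section Psd.
Variables (n : nat) (A : 'M[C]_n).
Hypothesis Apsd : psdmx A.

Lemma spectral_diagE i : spectral_diag A 0 i = (eigen A i)%:C.
Proof. by have /RRe_real := spectral_diag_real i (proj1 Apsd). Qed.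

Lemma hermfun_id : hermfun id A = A.
Proof.
rewrite hermfunE [RHS](hermsym_spectral (proj1 Apsd)).
by apply: eq_diag_in => i; rewrite -spectral_diagE.
Qed.

Lemma spectral_decomp :
  A = \sum_i (eigen A i)%:C *:
        (col i ((spectralmx A) ^t*) *m (col i ((spectralmx A) ^t*)) ^t*).
Proof. by rewrite -diag_in_sum -[LHS]hermfun_id hermfunE. Qed.

Lemma hform_id v : (hform id A v)%:C = (v ^t* *m A *m v) 0 0.
Proof. by rewrite hformE hermfun_id. Qed.

Lemma eigen_ge0 i : 0 <= eigen A i.
Proof. by rewrite -[eigen A i](hform_eigen id) -ler0c hform_id; case: Apsd. Qed.

End Psd.

Lemma psd_hform_ge0 n (A : 'M[C]_n) v : psdmx A -> 0 <= hform id A v.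
Proof. by move=> Apsd; rewrite -ler0c hform_id//; case: Apsd. Qed.

(** * The Jensen-type inequality for powers *)

Lemma coordB n (A : 'M[C]_n) u v i : coord A (u - v) i = coord A u i - coord A v i.
Proof. by rewrite /coord mulmxBr !mxE. Qed.

(** Multiplied by [x + t], the difference of the sides is [|(x + t) b - t a|^2], which vanishes at
    the [b] of the next lemma. *)
Lemma resolvent_form_le (x t : R) (a b : C) : 0 <= x -> 0 < t ->
  t * (abs2 a * (x / (x + t))) <= abs2 b * x + t * abs2 (a - b).
Proof.
case: a b => [a a'] [b b'] x0 t0; rewrite /abs2 /=.
have xt : 0 < x + t by rewrite ltr_wpDl.
rewrite -(ler_pM2r xt) -subr_ge0.
rewrite [X in 0 <= X](_ : _ = ((x + t) * b - t * a) ^+ 2 + ((x + t) * b' - t * a') ^+ 2).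
  by rewrite addr_ge0 ?sqr_ge0.
by field; rewrite gt_eqF.
Qed.

Lemma resolvent_form_eq (x t : R) (a : C) : 0 <= x -> 0 < t ->
  let b := (t / (x + t))%:C * a in
  abs2 b * x + t * abs2 (a - b) = t * (abs2 a * (x / (x + t))).
Proof.
case: a => [a a'] x0 t0; rewrite /abs2 /=.
have xt : 0 < x + t by rewrite ltr_wpDl.
by field; rewrite gt_eqF.
Qed.

(** For [s < 1], [sum_powR_le] reduces powers to [x / (x + t)]. There [t] times the right side is
    the minimum over [x] of [<x|B|x> + t |v - x|^2], and the images [L i *m x] of the minimiser are
    competitors for the [A i]. *)
Lemma hform_powR_le N m n (A : 'I_N -> 'M[C]_m) (L : 'I_N -> 'M[C]_(m, n))
    (c : 'I_N -> R) (B : 'M[C]_n) (s : R) :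
  (forall i, psdmx (A i)) -> psdmx B -> (forall i, 0 <= c i) ->
  0 < s -> s <= 1 ->
  (forall u, \sum_i sqnorm (L i *m u) <= sqnorm u) ->
  (forall u, \sum_i c i * hform id (A i) (L i *m u) <= hform id B u) ->
  forall v, \sum_i c i `^ s * hform (fun x => x `^ s) (A i) (L i *m v)
            <= hform (fun x => x `^ s) B v.
Proof.
move=> Apsd Bpsd c0 s0 s1 Lcontr LAB v.
have A0 i j : 0 <= eigen (A i) j by exact: eigen_ge0.
have B0 j : 0 <= eigen B j by exact: eigen_ge0.
(* For multiplicative [F] the factor [c i] moves into the eigenvalues, leaving one weighted sum over
   pairs. *)
have pairE (F : R -> R) :
  (forall i j, F (c i * eigen (A i) j) = F (c i) * F (eigen (A i) j)) ->
  \sum_i F (c i) * hform F (A i) (L i *m v) =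
  \sum_(p : 'I_N * 'I_m)
    abs2 (coord (A p.1) (L p.1 *m v) p.2) * F (c p.1 * eigen (A p.1) p.2).
  move=> FM; rewrite -(pair_bigA _ (fun i j =>
    abs2 (coord (A i) (L i *m v) j) * F (c i * eigen (A i) j)))/=.
  apply: eq_bigr => i _; rewrite mulr_sumr; apply: eq_bigr => j _.
  by rewrite FM mulrCA.
(* At [s = 1] the claim is [LAB] itself. *)
have [s1'|sge] := ltP s 1; last first.
  have -> : s = 1 by apply/le_anti; rewrite s1 sge.
  have E k (D : 'M[C]_k) u : psdmx D -> hform (fun x => x `^ 1) D u = hform id D u.
    by move=> Dpsd; apply: eq_bigr => i _; rewrite powRr1// eigen_ge0.
  rewrite E//; apply: le_trans (LAB v); apply: ler_sum => i _.
  by rewrite powRr1// E.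
rewrite (pairE (fun x => x `^ s)) => [|i j]; last by rewrite powRM.
apply: sum_powR_le => // [p|p|j|t t0]; rewrite ?abs2_ge0 ?mulr_ge0//.
(* Coordinates of the minimiser for [B], as in [resolvent_form_eq]. *)
pose a j := (t / (eigen B j + t))%:C * coord B v j.
pose x := (spectralmx B) ^t* *m \col_j a j.
have -> : \sum_j abs2 (coord B v j) * (eigen B j / (eigen B j + t))
  = t^-1 * (hform id B x + t * sqnorm (v - x)).
  rewrite -(sqnorm_coord B) mulr_sumr -big_split/= mulr_sumr.
  apply: eq_bigr => j _; rewrite coordB coord_spectral.
  by rewrite resolvent_form_eq// mulKf// gt_eqF.
rewrite -(ler_pM2l t0) mulVKf ?gt_eqF//.
apply: (@le_trans _ _ (\sum_i (c i * hform id (A i) (L i *m x)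
                              + t * sqnorm (L i *m (v - x))))).
  rewrite mulr_sumr -(pair_bigA _ (fun i j => t * (abs2 (coord (A i) (L i *m v) j) *
     (c i * eigen (A i) j / (c i * eigen (A i) j + t)))))/=.
  apply: ler_sum => i _; rewrite -(sqnorm_coord (A i)) !mulr_sumr -big_split/=.
  apply: ler_sum => j _; rewrite mulmxBr coordB [X in _ <= X + _]mulrCA.
  by apply: resolvent_form_le; rewrite // mulr_ge0.
rewrite big_split/= -mulr_sumr; apply: lerD; first exact: LAB.
by rewrite ler_pM2l.
Qed.

(** * Rank-one matrices and the value of [f_az] at [f1] *)

Lemma psdmx_rank1 n (v : 'cV[C]_n) : psdmx (v *m v ^t*).
Proof.
by split=> [|u]; [exact: rank1_herm | rewrite rank1_form; exact: mul_conjC_ge0].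
Qed.

(** The relation leaves only the eigenvalues 0 and [c], where [F x = (F c / c) * x]; if [c = 0],
    both sides are 0. *)
Lemma hermfun_quasi_proj F n (M : 'M[C]_n) (c : R) : psdmx M ->
  M *m M = c%:C *: M -> F 0 = 0 -> hermfun F M = (F c / c)%:C *: M.
Proof.
move=> Mpsd MM F0.
have lam i : eigen M i * eigen M i = c * eigen M i.
  have : hermfun (fun x => x * x) M = hermfun (fun x => c * id x) M.
    by rewrite hermfunZ -(hermfunM id id) hermfun_id.
  set v := (spectralmx M) ^t* *m \col_j (j == i)%:R => H.
  rewrite -(hform_eigen (fun x => x * x)) -(hform_eigen (fun x => c * id x)).
  by apply: complexI; rewrite !hformE H.
rewrite -[X in _ *: X]hermfun_id// -hermfunZ; apply: eq_hermfun => i.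
have /eqP := lam i; rewrite -subr_eq0 -mulrBl mulf_eq0 subr_eq0 => /orP[]/eqP ->.
  have [->|c0] := eqVneq c 0; first by rewrite F0 mulr0.
  by rewrite divfK.
by rewrite F0 mulr0.
Qed.

Lemma rank1_sqr n (v : 'cV[C]_n) :
  (v *m v ^t*) *m (v *m v ^t*) = (sqnorm v)%:C *: (v *m v ^t*).
Proof.
rewrite mulmxA -(mulmxA v) [_ *m v]mx11_scalar -sqnormE.
by rewrite mul_mx_scalar -scalemxAl.
Qed.

Lemma sqnorm_ket d : (0 < d)%N -> sqnorm (ket_f1 R d) = 1.
Proof.
move=> d0; rewrite /sqnorm; under eq_bigr do rewrite mxE /abs2 /= expr0n addr0.
rewrite sumr_const card_ord exprVn sqr_sqrtr// -[X in X = _]mulr_natl divff//.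
by rewrite pnatr_eq0 -lt0n.
Qed.

Lemma mxtrace_rank1 n (v : 'cV[C]_n) : \tr (v *m v ^t*) = (sqnorm v)%:C.
Proof. by rewrite mxtrace_mulC sqnormE /mxtrace big_ord1. Qed.

Lemma mxpowR_f1 d (p : R) : (0 < d)%N -> p != 0 -> mxpowR (f1 d) p = f1 d.
Proof.
move=> d0 p0; rewrite /mxpowR (hermfun_quasi_proj (c := 1)) ?powR0//.
- by rewrite powR1 divr1 scale1r.
- exact: psdmx_rank1.
- by rewrite rank1_sqr sqnorm_ket.
Qed.

(** Let [s = (1 - alpha) / z], [S = rho ^ (s / 2)] and [v = S f]. The inner matrix is [v v†], whose
    power [z] has trace [|v| ^ (2 z)], and [|v|^2 = <f|rho^s|f>]. *)
Lemma f_az_pure (alpha z : R) d (rho : 'M[C]_d) : (0 < d)%N ->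
  0 < alpha -> alpha < 1 -> 0 < z -> psdmx rho ->
  f_az alpha z (f1 d) rho =
  hform (fun x => x `^ ((1 - alpha) / z)) rho (ket_f1 R d) `^ z.
Proof.
move=> d0 a0 a1 z0 rho_psd; have b0 : 0 < 1 - alpha by rewrite subr_gt0.
rewrite /f_az mxpowR_f1 ?mulf_neq0 ?invr_neq0 ?gt_eqF//.
set p := (1 - alpha) / (2 * z); have p0 : p != 0 by rewrite gt_eqF// divr_gt0 ?mulr_gt0.
set S := mxpowR rho p; set v := S *m ket_f1 R d.
have -> : S *m f1 d *m S = v *m v ^t*.
  by rewrite trmxC_mul /S hermfun_herm !mulmxA.
have vpsd := psdmx_rank1 v; have vsqr := rank1_sqr v.
have pow0 : (0 : R) `^ z = 0 by rewrite powR0// gt_eqF.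
rewrite [mxpowR _ z](hermfun_quasi_proj vpsd vsqr pow0).
rewrite mxtraceZ mxtrace_rank1 -rmorphM /=.
have -> : hform (fun x => x `^ ((1 - alpha) / z)) rho (ket_f1 R d) = sqnorm v.
  have Sherm : S ^t* = S by exact: hermfun_herm.
  have SS : S *m S = hermfun (fun x => x `^ ((1 - alpha) / z)) rho.
    rewrite /S /mxpowR hermfunM; apply: eq_hermfun => i; rewrite -powRD.
      by congr (_ `^ _); rewrite /p; field; rewrite gt_eqF.
    by rewrite gt_eqF// addr_gt0// lt0r p0 divr_ge0 ?ltW// mulr_gt0.
  apply: complexI; rewrite hformE sqnormE trmxC_mul Sherm.
  by rewrite -SS -!mulmxA.
have [->|v0] := eqVneq (sqnorm v) 0; first by rewrite mulr0 powR0// gt_eqF.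
by rewrite divfK.
Qed.

(** * Concavity in the state and scalar Jensen inequality *)

Lemma psdmx_sum N n (p : 'I_N -> R) (A : 'I_N -> 'M[C]_n) :
  (forall i, 0 <= p i) -> (forall i, psdmx (A i)) ->
  psdmx (\sum_i (p i)%:C *: A i).
Proof.
move=> p0 Apsd; split.
  apply/hermsymP/matrixP => k l; rewrite !mxE !summxE rmorph_sum.
  apply: eq_bigr => i _; rewrite !mxE rmorphM; congr (_ * _).
    exact/esym/conjc_real.
  by have /hermsymP/matrixP/(_ k l) := proj1 (Apsd i); rewrite !mxE.
move=> v; rewrite mulmx_sumr mulmx_suml summxE; apply: sumr_ge0 => i _.
rewrite -scalemxAr -scalemxAl mxE mulr_ge0 ?ler0c//.
exact: (proj2 (Apsd i)).
Qed.

Lemma hform_id_sum N n (p : 'I_N -> R) (A : 'I_N -> 'M[C]_n) v :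
  (forall i, 0 <= p i) -> (forall i, psdmx (A i)) ->
  hform id (\sum_i (p i)%:C *: A i) v = \sum_i p i * hform id (A i) v.
Proof.
move=> p0 Apsd; apply: complexI; rewrite hform_id; last exact: psdmx_sum.
rewrite mulmx_sumr mulmx_suml summxE rmorph_sum; apply: eq_bigr => i _.
by rewrite rmorphM /= hform_id// -scalemxAr -scalemxAl mxE.
Qed.

Lemma hform_scale F n (A : 'M[C]_n) (k : R) v :
  hform F A (k%:C *: v) = k ^+ 2 * hform F A v.
Proof.
rewrite /hform mulr_sumr; apply: eq_bigr => i _; rewrite mulrA; congr (_ * _).
rewrite /coord -scalemxAr mxE; case: (_ i 0) => a b.
by rewrite /abs2 /=; ring.
Qed.

Lemma sqnorm_scale n (k : R) (v : 'cV[C]_n) :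
  sqnorm (k%:C *: v) = k ^+ 2 * sqnorm v.
Proof.
rewrite /sqnorm mulr_sumr; apply: eq_bigr => i _.
by rewrite mxE; case: (v i 0) => a b; rewrite /abs2 /=; ring.
Qed.

Lemma hform_powR_ge0 s n (A : 'M[C]_n) v : 0 <= hform (fun x => x `^ s) A v.
Proof. by apply: sumr_ge0 => i _; rewrite mulr_ge0 ?abs2_ge0 ?powR_ge0. Qed.

Definition root_hform s n (A : 'M[C]_n) v := hform (fun x => x `^ s) A v `^ s^-1.

(** By homogeneity, the factor [c i] brings the root form of [A i], when nonzero, to the common
    value [H]. The Jensen-type inequality then applies to the scalar matrices [sqrt (r i)], whose
    squares sum to 1. *)
Lemma root_hform_concave N n (p : 'I_N -> R) (A : 'I_N -> 'M[C]_n) s v :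
  0 < s -> s <= 1 -> (forall i, 0 <= p i) -> (forall i, psdmx (A i)) ->
  \sum_i p i * root_hform s (A i) v <= root_hform s (\sum_i (p i)%:C *: A i) v.
Proof.
move=> s0 s1 p0 Apsd; pose g D := root_hform s D v; rewrite -/(g _).
under eq_bigr do rewrite -/(g _).
set B := \sum_i _ *: _; set H := \sum_i _.
have sN0 : s != 0 by rewrite gt_eqF.
have g0 D : 0 <= g D by exact: powR_ge0.
have ge D : hform (fun x => x `^ s) D v = g D `^ s.
  by rewrite /g /root_hform -powRrM mulVf// powRr1// hform_powR_ge0.
have pg0 i : 0 <= p i * g (A i) by rewrite mulr_ge0.
have : 0 <= H by exact: sumr_ge0.
rewrite le_eqVlt => /predU1P[<-//|H0].
have HN0 : H != 0 by rewrite gt_eqF.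
(* With these weights [c i * r i = p i] and both bounds become sums of [r i], so the
   inequality reads [H `^ s <= g B `^ s]. *)
pose r i := p i * g (A i) / H; pose c i := H / g (A i).
have r0 i : 0 <= r i by rewrite divr_ge0// ltW.
have c0 i : 0 <= c i by rewrite divr_ge0// ltW.
have sqrtr i : Num.sqrt (r i) ^+ 2 = r i by rewrite sqr_sqrtr.
have r_sum : \sum_i r i = 1 by rewrite -mulr_suml divff.
have := @hform_powR_le N n n A (fun i => (Num.sqrt (r i))%:C%:M) c B s.
move=> /(_ Apsd (psdmx_sum p0 Apsd) c0 s0 s1) key.
have {key} : H `^ s <= hform (fun x => x `^ s) B v.
  apply: le_trans (key _ _ v).
  - rewrite -[X in X <= _]mul1r -r_sum mulr_suml.
    apply: ler_sum => i _; rewrite mul_scalar_mx hform_scale sqrtr ge.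
    have [gi0|giN0] := eqVneq (g (A i)) 0.
      by rewrite /r gi0 mulr0 !mul0r mulr0.
    rewrite mulrCA -powRM// /c divfK// lexx.
  - move=> u; rewrite -[X in _ <= X]mul1r -r_sum mulr_suml.
    by apply: ler_sum => i _; rewrite mul_scalar_mx sqnorm_scale sqrtr.
  - move=> u; rewrite hform_id_sum//; apply: ler_sum => i _.
    rewrite mul_scalar_mx hform_scale sqrtr mulrA ler_wpM2r ?psd_hform_ge0//.
    (* If [g (A i) = 0] then [c i = 0] by the convention for division, and the bound is
       [0 <= p i]. *)
    rewrite /c /r; have [->|giN0] := eqVneq (g (A i)) 0.
      by rewrite invr0 mulr0 mul0r.
    rewrite (_ : _ * _ = p i)//; move: (H) HN0 => h hN0.
    by field; rewrite giN0 hN0.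
rewrite ge => Hs; rewrite leNgt; apply/negP => lt_gH.
have := gt0_ltr_powR s0 _ _ lt_gH; rewrite !nnegrE g0 (ltW H0) => /(_ isT isT).
by rewrite ltNge Hs.
Qed.

(** The concave [x ^ a] lies below its tangent at [M]: Young's inequality for [(x / M) ^ a] and 1
    with exponents [1 / a] and [1 / (1 - a)]. *)
Lemma powR_tangent (a x M : R) : 0 < a -> a < 1 -> 0 <= x -> 0 < M ->
  x `^ a <= M `^ a * (a * (x / M) + (1 - a)).
Proof.
move=> a0 a1 x0 M0; have xM : 0 <= x / M by rewrite divr_ge0// ltW.
rewrite -[x in x `^ a](divfK (x := M)) ?gt_eqF// powRM ?(ltW M0)// mulrC.
rewrite ler_pM2l ?powR_gt0//.
have b0 : 0 < 1 - a by rewrite subr_gt0.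
have := @conjugate_powR R ((x / M) `^ a) 1 a^-1 (1 - a)^-1.
rewrite mulr1 -powRrM mulfV ?gt_eqF// powRr1// powR1 !invrK => H.
apply: le_trans (H _ _ _ _ _) _; rewrite ?powR_ge0 ?invr_gt0//; first by ring.
by rewrite mul1r mulrC.
Qed.

Lemma powR_jensen N (p x : 'I_N -> R) (a : R) : 0 < a -> a < 1 ->
  (forall i, 0 <= p i) -> \sum_i p i = 1 -> (forall i, 0 <= x i) ->
  \sum_i p i * x i `^ a <= (\sum_i p i * x i) `^ a.
Proof.
move=> a0 a1 p0 p1 x0; set M := \sum_i p i * x i.
have px0 i : 0 <= p i * x i by rewrite mulr_ge0.
have : 0 <= M by exact: sumr_ge0.
(* There is no tangent at [M = 0], but then every [p i * x i] vanishes. *)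
rewrite le_eqVlt => /predU1P[M0|M0].
  rewrite big1 ?powR_ge0// => i _.
  have /eqP : p i * x i = 0.
    by apply/le_anti; rewrite px0 andbT M0 /M (bigD1 i)//= lerDl sumr_ge0.
  by rewrite mulf_eq0 => /orP[]/eqP->; rewrite ?mul0r ?powR0 ?mulr0 ?gt_eqF.
have -> : M `^ a = \sum_i p i * (M `^ a * (a * (x i / M) + (1 - a))).
  under eq_bigr => i _ do rewrite mulrCA mulrDr [p i * (a * _)]mulrCA mulrA.
  rewrite -mulr_sumr big_split/= -mulr_suml p1 mul1r.
  under eq_bigr => i _ do rewrite -mulrA [p i * _]mulrA.
  rewrite -mulr_sumr -mulr_suml -/M divff ?gt_eqF// mulr1.
  by rewrite addrC subrK mulr1.
by apply: ler_sum => i _; rewrite ler_wpM2l// powR_tangent.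
Qed.

Lemma sum_eigen n (A : 'M[C]_n) : psdmx A -> (\sum_i eigen A i)%:C = \tr A.
Proof. by move=> Apsd; rewrite -[in RHS](hermfun_id Apsd) mxtrace_hermfun. Qed.

(** Nonnegative eigenvalues of sum 1 are at most 1, and so are their powers. *)
Lemma hform_powR_density s n (rho : 'M[C]_n) v : 0 <= s -> densitymx rho ->
  hform (fun x => x `^ s) rho v <= sqnorm v.
Proof.
move=> s0 [rho_psd tr1]; rewrite -(sqnorm_coord rho); apply: ler_sum => i _.
rewrite ler_piMr ?abs2_ge0//.
have e0 := eigen_ge0 rho_psd.
have -> : 1 = 1 `^ s :> R by rewrite powR1.
apply: ge0_ler_powR; rewrite ?nnegrE//.
have <- : \sum_i eigen rho i = 1 by apply: complexI; rewrite sum_eigen.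
by rewrite (bigD1 i)//= lerDl sumr_ge0.
Qed.

(** * Completely positive maps that fix a rank-one projection *)

Lemma ampliationE k n (Phi : 'M[C]_n -> 'M[C]_n) (X : 'M[C]_(k * n)) a i b j :
  ampliation Phi X (mxtens_index (a, i)) (mxtens_index (b, j)) =
  Phi (\matrix_(i, j) X (mxtens_index (a, i)) (mxtens_index (b, j))) i j.
Proof.
rewrite /ampliation summxE; under eq_bigr do rewrite summxE.
rewrite (bigD1 a)//= [X in _ + X]big1 ?addr0 => [|a' aa'].
  rewrite (bigD1 b)//= [X in _ + X]big1 ?addr0 => [|b' bb'].
    by rewrite tensmxE !mxE !eqxx mul1r.
  by rewrite tensmxE mxE [b == _]eq_sym (negbTE bb') andbF mul0r.
rewrite big1// => b' _.
by rewrite tensmxE mxE [a == _]eq_sym (negbTE aa') mul0r.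
Qed.

(** Stacks the [x a] in the index order of [tensmx], so that its rank-one matrix has the blocks
    [x a *m (x b) ^t*]. *)
Definition blockvec k n (x : 'I_k -> 'cV[C]_n) : 'cV[C]_(k * n) :=
  \col_l x (mxtens_unindex l).1 (mxtens_unindex l).2 0.

Lemma blockvec_rank1 k n (x : 'I_k -> 'cV[C]_n) a b :
  \matrix_(i, j) (blockvec x *m (blockvec x) ^t*)
                   (mxtens_index (a, i)) (mxtens_index (b, j))
  = x a *m (x b) ^t*.
Proof.
by apply/matrixP => i j; rewrite !mxE !big_ord1 !mxE !mxtens_indexK.
Qed.

Lemma sum_mxtens_index k n (F : 'I_(k * n) -> C) :
  \sum_l F l = \sum_a \sum_i F (mxtens_index (a, i)).
Proof.
rewrite pair_bigA /= (reindex (@mxtens_index k n)).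
  by apply: eq_bigr => -[].
by exists (@mxtens_unindex k n) => l _; rewrite ?mxtens_indexK ?mxtens_unindexK.
Qed.

Section Channel.
Variables (n : nat) (Phi : {linear 'M[C]_n -> 'M[C]_n}).
Hypothesis Phi_cp : completely_positive Phi.

Lemma cp_form k (x y : 'I_k -> 'cV[C]_n) :
  0 <= \sum_a \sum_b ((y a) ^t* *m Phi (x a *m (x b) ^t*) *m y b) 0 0.
Proof.
have [_ /(_ (blockvec y))] := Phi_cp (psdmx_rank1 (blockvec x)).
congr (_ <= _); rewrite mxE sum_mxtens_index [RHS]exchange_big /=.
apply: eq_bigr => b _; under [RHS]eq_bigr do rewrite mxE.
rewrite [RHS]exchange_big /=; apply: eq_bigr => j _.
rewrite mxE sum_mxtens_index mulr_suml; apply: eq_bigr => a _.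
rewrite [blockvec _ _ _]mxE mxtens_indexK; congr (_ * _).
rewrite mxE; apply: eq_bigr => i _.
by rewrite ampliationE blockvec_rank1 !mxE mxtens_indexK.
Qed.

Lemma cp_herm k (x : 'I_k -> 'cV[C]_n) a b :
  Phi (x a *m (x b) ^t*) = (Phi (x b *m (x a) ^t*)) ^t*.
Proof.
have [/hermsymP/matrixP H _] := Phi_cp (psdmx_rank1 (blockvec x)).
apply/matrixP => i j; have := H (mxtens_index (a, i)) (mxtens_index (b, j)).
rewrite [in X in _ = X]mxE [in X in _ = X]mxE !ampliationE !blockvec_rank1 => ->.
by rewrite !mxE.
Qed.

Lemma psdmx_cp_rank1 (x : 'cV[C]_n) : psdmx (Phi (x *m x ^t*)).
Proof.
split; first exact/hermsymP/(@cp_herm 1 (fun=> x) ord0 ord0).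
by move=> v; have := @cp_form 1 (fun=> x) (fun=> v); rewrite !big_ord1.
Qed.

(** The matrix of [x |-> Phi (x v†) v], given by its columns. *)
Definition rank1_compression (v : 'cV[C]_n) : 'M[C]_n :=
  \matrix_(i, j) (Phi (delta_mx j 0 *m v ^t*) *m v) i 0.

Lemma rank1_compressionE v (x : 'cV[C]_n) :
  rank1_compression v *m x = Phi (x *m v ^t*) *m v.
Proof.
rewrite [in RHS](matrix_sum_delta x).
under eq_bigr do rewrite big_ord1.
rewrite mulmx_suml linear_sum mulmx_suml.
apply/matrixP => i j; rewrite (ord1 j) mxE summxE; apply: eq_bigr => k _.
by rewrite -scalemxAl linearZ_LR -scalemxAl !mxE mulrC.
Qed.


(** [schwarz_block] for [x] and [v]: the corner [Phi (v v†) = v v†] has expectation 1 at [v]. This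
    is the rank-one case of [K A K† <= Phi A]. *)
Lemma schwarz_cp (v x u : 'cV[C]_n) : sqnorm v = 1 ->
  Phi (v *m v ^t*) = v *m v ^t* ->
  (abs2 ((u ^t* *m (rank1_compression v *m x)) 0 0))%:C
  <= (u ^t* *m Phi (x *m x ^t*) *m u) 0 0.
Proof.
move=> v1 Phiv; pose X (a : 'I_2) := if a == 0 then x else v.
rewrite abs2E rank1_compressionE mulmxA.
have := @schwarz_block _ _ u v (fun a b => Phi (X a *m (X b) ^t*)) _ _ _.
apply.
- exact: cp_form.
- exact: cp_herm.
- by rewrite [X 1]/= Phiv rank1_form -sqnormE v1 mul1r conjC1.
Qed.

Lemma psdmx_cp (A : 'M[C]_n) : psdmx A -> psdmx (Phi A).
Proof.
move=> Apsd; rewrite (spectral_decomp Apsd) linear_sum.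
under eq_bigr do rewrite linearZ_LR.
by apply: psdmx_sum => i; [exact: eigen_ge0 | exact: psdmx_cp_rank1].
Qed.

(** The spectral decomposition of [A] and linearity reduce the claim to rank one. *)
Lemma compression_form_le (v u : 'cV[C]_n) (A : 'M[C]_n) : sqnorm v = 1 ->
  Phi (v *m v ^t*) = v *m v ^t* -> psdmx A ->
  hform id A ((rank1_compression v) ^t* *m u) <= hform id (Phi A) u.
Proof.
move=> v1 Phiv Apsd; rewrite -lecR (hform_id Apsd) (hform_id (psdmx_cp Apsd)).
rewrite [in X in X <= _](spectral_decomp Apsd).
rewrite [in X in _ <= X](spectral_decomp Apsd) [Phi _]linear_sum.
rewrite 2!mulmx_sumr 2!mulmx_suml 2!summxE; apply: ler_sum => i _.
set x := col i _; rewrite [Phi _]linearZ_LR.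
have ZE (c : C) (w : 'cV[C]_n) (M : 'M[C]_n) :
    (w ^t* *m (c *: M) *m w) 0 0 = c * (w ^t* *m M *m w) 0 0.
  by rewrite -scalemxAr -scalemxAl mxE.
rewrite 2!ZE ler_wpM2l ?ler0c ?eigen_ge0//.
apply: le_trans (schwarz_cp x u v1 Phiv).
by rewrite rank1_form trmxC_mul trmxCK -mulmxA mulrC abs2E.
Qed.

(** Summing the Schwarz bound over the basis vectors [u] gives
    [|K x|^2 <= tr (Phi (x x†)) = tr (x x†)]. *)
Lemma sqnorm_compression (v x : 'cV[C]_n) : trace_preserving Phi ->
  sqnorm v = 1 -> Phi (v *m v ^t*) = v *m v ^t* ->
  sqnorm (rank1_compression v *m x) <= sqnorm x.
Proof.
move=> Phi_tp v1 Phiv; rewrite -lecR -(mxtrace_rank1 x) -Phi_tp rmorph_sum.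
apply: ler_sum => i _; have := schwarz_cp x (delta_mx i 0) v1 Phiv.
have -> : (delta_mx i 0 : 'cV[C]_n) ^t* = delta_mx 0 i.
  by rewrite trmx_delta map_delta_mx.
by rewrite -!rowE -colE !mxE.
Qed.

(** With [w = K† y], [0 <= |y - K w|^2] gives [2 |w|^2 <= |y|^2 + |K w|^2 <= |y|^2 + |w|^2]. *)
Lemma sqnorm_adj_le m (K : 'M[C]_(m, n)) : (forall x, sqnorm (K *m x) <= sqnorm x) ->
  forall y, sqnorm (K ^t* *m y) <= sqnorm y.
Proof.
move=> Kle y; set w := K ^t* *m y.
have : 0 <= sqnorm (y - K *m w) by exact: sqnorm_ge0.
have -> : sqnorm (y - K *m w) = sqnorm y - 2 * sqnorm w + sqnorm (K *m w).
  apply: complexI; rewrite rmorphD rmorphB rmorphM /= 4!sqnormE.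
  by rewrite sqr_sub_form rmorph_nat.
by have := Kle w; lra.
Qed.

Lemma sqnorm_eq0 (v : 'cV[C]_n) : sqnorm v <= 0 -> v = 0.
Proof.
move=> v0; apply/colP => i; rewrite mxE.
have : abs2 (v i 0) <= 0.
  apply: le_trans v0; rewrite /sqnorm (bigD1 i)//= lerDl.
  by apply: sumr_ge0 => j _; exact: abs2_ge0.
case: (v i 0) => a b; rewrite /abs2 /= => ab.
by apply/eqP; rewrite eq_complex /=; apply/andP; split; apply/eqP; nra.
Qed.

(** [K v = v] and [|K† v| <= 1] give [|K† v - v|^2 = |K† v|^2 - 1 <= 0]. *)
Lemma compression_adj_fix (v : 'cV[C]_n) : trace_preserving Phi -> sqnorm v = 1 ->
  Phi (v *m v ^t*) = v *m v ^t* -> (rank1_compression v) ^t* *m v = v.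
Proof.
move=> Phi_tp v1 Phiv; set K := rank1_compression v.
have vv : v ^t* *m v = 1%:M by rewrite [LHS]mx11_scalar -sqnormE v1.
have Kv : K *m v = v by rewrite rank1_compressionE Phiv -mulmxA vv mulmx1.
have Kle := sqnorm_adj_le (fun x => sqnorm_compression x Phi_tp v1 Phiv) v.
apply/eqP; rewrite -subr_eq0; apply/eqP/sqnorm_eq0.
suff -> : sqnorm (K ^t* *m v - v) = sqnorm (K ^t* *m v) - 1.
  by rewrite subr_le0 -v1.
apply: complexI; rewrite rmorphB /= 2!sqnormE.
by apply: fixed_sub_form => //; rewrite -sqnormE v1.
Qed.

Lemma hform_powR_compression s (v : 'cV[C]_n) (A : 'M[C]_n) : 0 < s -> s <= 1 ->
  trace_preserving Phi -> sqnorm v = 1 -> Phi (v *m v ^t*) = v *m v ^t* ->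
  psdmx A ->
  hform (fun x => x `^ s) A v <= hform (fun x => x `^ s) (Phi A) v.
Proof.
move=> s0 s1 Phi_tp v1 Phiv Apsd.
have := @hform_powR_le 1 n n (fun=> A) (fun=> (rank1_compression v) ^t*)
  (fun=> 1) (Phi A) s.
move=> /(_ (fun=> Apsd) (psdmx_cp Apsd) (fun=> ler01) s0 s1).
move=> H; have {H} := H _ _ v; rewrite big_ord1 powR1 mul1r compression_adj_fix//.
apply=> u; rewrite big_ord1 ?mul1r.
  by apply: sqnorm_adj_le => x; exact: sqnorm_compression.
exact: compression_form_le.
Qed.

End Channel.

End HermitianForms.

(** * Assembly of (T1), (T2) and (T3) *)

Theorem theorem1 (R : realType) (d : nat) (hd : (0 < d)%N) (alpha z : R)
  (halpha0 : 0 < alpha) (halpha1 : alpha < 1)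
  (hz : Num.max alpha (1 - alpha) <= z) :
  [/\ (forall rho : 'M[R[i]]_d, densitymx rho -> 0 <= T_GR alpha z rho)
        /\ T_GR alpha z (f1 d) = 0,
      forall (rho : 'M[R[i]]_d) (Phi : {linear 'M[R[i]]_d -> 'M[R[i]]_d}),
        densitymx rho -> texture_free Phi ->
        T_GR alpha z (Phi rho) <= T_GR alpha z rho
    & forall (N : nat) (p : 'I_N -> R) (rho : 'I_N -> 'M[R[i]]_d),
        (forall n, 0 <= p n) -> \sum_(n < N) p n = 1 ->
        (forall n, densitymx (rho n)) ->
        T_GR alpha z (\sum_(n < N) (p n)%:C *: rho n)
          <= \sum_(n < N) p n * T_GR alpha z (rho n)].
Proof.
have [z0 za] : 0 < z /\ 1 - alpha <= z.
  by move: hz; rewrite ge_max => /andP[az ->]; split=> //; exact: lt_le_trans az.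
have a0 : 0 < 1 - alpha by rewrite subr_gt0.
have a1 : 1 - alpha < 1 by rewrite gtrBl.
set s := (1 - alpha) / z; have s0 : 0 < s by rewrite divr_gt0.
(* Here [1 - alpha <= z] enters. *)
have s1 : s <= 1 by rewrite ler_pdivrMr// mul1r.
have sN0 : s != 0 by rewrite gt_eqF.
have ket1 := @sqnorm_ket R d hd; set f := ket_f1 R d in ket1.
pose g rho := hform (fun x => x `^ s) rho f.
have g0 rho : 0 <= g rho by exact: hform_powR_ge0.
have TE rho : psdmx rho -> T_GR alpha z rho = 1 - g rho `^ z.
  by move=> rho_psd; rewrite /T_GR f_az_pure.
have monoz (x y : R) : 0 <= x -> x <= y -> x `^ z <= y `^ z.
  move=> x0 xy; apply: ge0_ler_powR => //; rewrite ?nnegrE ?(ltW z0)//.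
  exact: le_trans xy.
split; first split.
- move=> rho rhoD; rewrite TE ?subr_ge0; last by case: rhoD.
  apply: (@le_trans _ _ (1 `^ z)); last by rewrite powR1.
  by apply: monoz => //; rewrite -ket1; apply: hform_powR_density => //; exact: ltW.
(* The projection [f1] is its own power [s], and [<f|f1|f> = |<f|f>|^2 = 1]. *)
- rewrite (TE _ (psdmx_rank1 f)) (_ : g _ = 1) ?powR1 ?subrr//.
  apply: complexI; rewrite hformE [hermfun _ _](mxpowR_f1 hd sN0) rank1_form.
  by rewrite -sqnormE ket1 conjC1 mulr1.
- move=> rho Phi [rho_psd _] [Phi_cp Phi_tp Phi_f].
  rewrite (TE _ rho_psd) (TE _ (psdmx_cp Phi_cp rho_psd)) lerD2l lerN2.
  apply: monoz; first exact: g0.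
  exact: hform_powR_compression.
- move=> N p rho p0 p1 rhoD; have rho_psd n := proj1 (rhoD n).
  rewrite (TE _ (psdmx_sum p0 rho_psd)).
  have -> : \sum_n p n * T_GR alpha z (rho n) = 1 - \sum_n p n * g (rho n) `^ z.
    rewrite -[in RHS]p1 -sumrB; apply: eq_bigr => i _.
    by rewrite (TE _ (rho_psd i)) mulrBr mulr1.
  rewrite lerD2l lerN2.
  (* The exponents match because [s * z = 1 - alpha]. *)
  have gE A : g A `^ z = root_hform s A f `^ (1 - alpha).
    rewrite /root_hform -powRrM; congr (_ `^ _).
    by rewrite /s; field; rewrite !gt_eqF.
  rewrite gE; under eq_bigr do rewrite gE.
  (* Concavity of [x ^ (1 - alpha)] comes first, then concavity of [root_hform] under this
     increasing power. *)
  apply: (@le_trans _ _ ((\sum_i p i * root_hform s (rho i) f) `^ (1 - alpha))).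
    by apply: powR_jensen => // i; exact: powR_ge0.
  have root0 A : 0 <= root_hform s A f by exact: powR_ge0.
  apply: ge0_ler_powR; rewrite ?nnegrE ?(ltW a0)//.
    by apply: sumr_ge0 => i _; rewrite mulr_ge0.
  exact: root_hform_concave.
Qed.
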